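(* Let $\boldsymbol\varepsilon$ be an $m$-dimensional random vector with finite second order moments, $\mathrm E\,\boldsymbol\varepsilon=\mathbf 0$ and $\mathrm{Var}\,\boldsymbol\varepsilon=\boldsymbol\Omega$. If $H_0(\mathbf u)$ holds, i.e. $\mathcal L(\boldsymbol\varepsilon)=\mathcal L(\mathbf R_{\mathbf u}\boldsymbol\varepsilon)$, then $\mathbf u$ is an eigenvector of $\boldsymbol\Omega$.
   Context: $m\ge2$ is an integer, $\mathbf u\in\mathbb R^m$ is a fixed vector with $\|\mathbf u\|=1$, $\mathbf R_{\mathbf u}=2\mathbf u\mathbf u^\top-\mathbf I$, and $\mathcal L(\boldsymbol Z)$ denotes the distribution of $\boldsymbol Z$. *)

(* Defs.v *)
From HB Require Import structures.
From mathcomp Require Import all_boot all_order all_algebra.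
From mathcomp Require Import all_classical all_reals all_analysis.

Set Implicit Arguments.
Unset Strict Implicit.
Unset Printing Implicit Defensive.

Import Order.TTheory GRing.Theory Num.Theory.
Import numFieldNormedType.Exports.

Local Open Scope classical_set_scope.
Local Open Scope ring_scope.

Definition borel_mx_display : measure_display.
Proof. exact: default_measure_display. Qed.

(* Matrices (in particular the column vectors of R^m) carry the Borel
   sigma-algebra of their usual topology. *)
Section borel_matrix.
Context {R : realType} (m n : nat).

Let borel : set (set 'M[R]_(m, n)) := <<s @open 'M[R]_(m, n) >>.

Let borel0 : borel set0.
Proof. exact: sigma_algebra0. Qed.

Let borelC A : borel A -> borel (~` A).
Proof. exact: sigma_algebraC. Qed.

Let borel_bigcup (F : (set 'M[R]_(m, n))^nat) :
  (forall i, borel (F i)) -> borel (\bigcup_i F i).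
Proof. exact: sigma_algebra_bigcup. Qed.

HB.instance Definition _ := @isMeasurable.Build borel_mx_display
  'M[R]_(m, n) borel borel0 borelC borel_bigcup.

End borel_matrix.

(* The library norm `|u| of a matrix is the sup norm. *)
Definition euclidean_norm (R : realType) (m : nat) (u : 'cV[R]_m) : R :=
  Num.sqrt (\sum_i u i ord0 ^+ 2).

Definition refl_mx (R : realType) (m : nat) (u : 'cV[R]_m) : 'M[R]_m :=
  2 *: (u *m u^T) - 1%:M.

(* The library's eigenspaces consist of row vectors, acted on from the right. *)
Definition is_eigenvector (R : realType) (m : nat) (A : 'M[R]_m)
    (v : 'cV[R]_m) : Prop :=
  v != 0 /\ exists a : R, A *m v = a *: v.

Section random_vector.
Context d (T : measurableType d) (R : realType) (P : probability T R).

Definition finite_second_moments (m : nat) (X : T -> 'cV[R]_m) : Prop :=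
  forall i, (fun w => X w i ord0) \in Lfun P 2%:E.

(* fine is harmless in the next two definitions for vectors with finite second
   moments: all the expectations involved are then finite. *)
Definition mean_vector (m : nat) (X : T -> 'cV[R]_m) : 'cV[R]_m :=
  \col_i fine ('E_P[fun w => X w i ord0])%E.

Definition covariance_mx (m : nat) (X : T -> 'cV[R]_m) : 'M[R]_m :=
  \matrix_(i, j)
    fine (covariance P (fun w => X w i ord0) (fun w => X w j ord0)).

(* Laws are compared on measurable sets only: the value of a measure of the
   library on a nonmeasurable set is meaningless. *)
Definition same_law d' (T' : measurableType d') (X Y : T -> T') : Prop :=
  forall A : set T', measurable A -> pushforward P X A = pushforward P Y A.

Definition H0 (m : nat) (u : 'cV[R]_m) (X : T -> 'cV[R]_m) : Prop :=
  same_law X (fun w => refl_mx u *m X w).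

End random_vector.

(* Main.v *)
From HB Require Import structures.
Require Import Defs.
From mathcomp Require Import all_boot all_order all_algebra.
From mathcomp Require Import all_classical all_reals all_analysis.
From mathcomp Require Import ring measurable_realfun.

Set Implicit Arguments.
Unset Strict Implicit.
Unset Printing Implicit Defensive.

Import Order.TTheory GRing.Theory Num.Theory.
Import numFieldNormedType.Exports.

Local Open Scope classical_set_scope.
Local Open Scope ring_scope.

(* Put Z = u^T epsilon. Since u^T R_u = u^T, the pairs (epsilon_i, Z) and
   ((R_u epsilon)_i, Z) = (2 u_i Z - epsilon_i, Z) have the same law, so
   E[epsilon_i Z] = 2 u_i E[Z^2] - E[epsilon_i Z], that is,
   (Omega u)_i = E[epsilon_i Z] = E[Z^2] u_i. *)

Lemma measurable_coord_mx (R : realType) m n (i : 'I_m) (j : 'I_n) :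
  measurable_fun [set: 'M[R]_(m, n)] (fun M : 'M[R]_(m, n) => M i j).
Proof.
apply: (measurability _ (RGenOpens.measurableE R)) => _ [_ [a [b ->] <-]].
rewrite setTI; apply: sub_gen_smallest.
have /continuousP/(_ `]a, b[%classic) := @coord_continuous R m n i j.
by apply; exact: interval_open.
Qed.

(** The topology on matrices is entrywise, so finitely many conditions on the entries suffice, and
    each entry of the product is a finite sum of coordinates times constants. *)
Lemma continuous_mulmx (R : realType) m n p (A : 'M[R]_(m, n)) :
  continuous (fun M : 'M[R]_(n, p) => A *m M).
Proof.
move=> M B [P MP sPB].
suff : \forall N \near M, forall i j, P i j ((A *m N) i j).
  by apply: filterS => N PN; exact: sPB.
apply: (@filter_forall _ _ _ (nbhs M)) => i.
apply: (@filter_forall _ _ _ (nbhs M)) => j.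
suff /(_ _ (MP i j)) :
  (fun N : 'M[R]_(n, p) => (A *m N) i j) @ M --> (A *m M) i j by exact.
under eq_fun do rewrite mxE.
rewrite mxE; apply: (@cvg_big _ _ +%R _ _ _ _ (nbhs M)) => [|k _].
  exact: add_continuous.
apply: cvgM; first exact: cvg_cst.
exact: coord_continuous.
Qed.

Lemma measurable_mulmx (R : realType) m n p (A : 'M[R]_(m, n)) :
  measurable_fun [set: 'M[R]_(n, p)] (fun M : 'M[R]_(n, p) => A *m M).
Proof.
apply: (@measurability _ _ _ _ _ _ (@open 'M[R]_(m, p))) => // _ [B oB <-].
rewrite setTI; apply: sub_gen_smallest.
have /continuousP/(_ B) := @continuous_mulmx R m n p A; exact.
Qed.

(** Unit length gives [u^T *m u = 1], so the product is twice [u^T] minus [u^T]. This is what makes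
    [Z] invariant under the reflection. *)
Lemma mulmx_refl_mx_euclidean (R : realType) m (u : 'cV[R]_m) :
  euclidean_norm u = 1 -> u^T *m refl_mx u = u^T.
Proof.
move=> u1; have uu : u^T *m u = 1%:M.
  apply/matrixP => i j; rewrite !ord1 !mxE -[RHS](expr1n _ 2) -u1.
  rewrite sqr_sqrtr; first by apply: eq_bigr => k _; rewrite mxE.
  by apply: sumr_ge0 => k _; exact: sqr_ge0.
rewrite /refl_mx mulmxBr -scalemxAr mulmxA uu mul1mx mulmx1.
by rewrite scaler_nat mulr2n addrK.
Qed.

Section expectation_law.
Context d (T : measurableType d) (R : realType) (P : probability T R).

(** By change of variables, both sides are integrals of [f] against the pushforward measures, which
    agree on measurable sets. *)
Lemma same_law_expectation d' (T' : measurableType d') (X Y : T -> T')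
    (f : T' -> R) :
  measurable_fun setT X -> measurable_fun setT Y -> measurable_fun setT f ->
  same_law P X Y -> f \o X \in Lfun P 1 -> f \o Y \in Lfun P 1 ->
  ('E_P[f \o X] = 'E_P[f \o Y])%E.
Proof.
move=> mX mY mf XY /Lfun1_integrable fX /Lfun1_integrable fY.
pose X' : {mfun T >-> T'} := HB.pack X (isMeasurableFun.Build _ _ _ _ X mX).
pose Y' : {mfun T >-> T'} := HB.pack Y (isMeasurableFun.Build _ _ _ _ Y mY).
rewrite unlock.
have mf' : measurable_fun setT (EFin \o f) by exact/measurable_EFinP.
have := @integral_distribution _ _ _ _ _ P X' _ mf' fX.
have := @integral_distribution _ _ _ _ _ P Y' _ mf' fY.
move=> <- <-; apply: eq_measure_integral => A mA _; exact: XY.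
Qed.

(** The product of the means drops out of the covariance: the mean of [X] is finite by
    integrability, so it is 0 once its [fine] is. *)
Lemma covariance_centered (X Y : T -> R) :
  X \in Lfun P 2%:E -> Y \in Lfun P 2%:E -> fine 'E_P[X] = 0 ->
  covariance P X Y = 'E_P[X \* Y]%E.
Proof.
move=> X2 Y2 X0; have Pfin : P setT \is a fin_num by exact: fin_num_measure.
have X1 := Lfun_subset12 Pfin X2; have Y1 := Lfun_subset12 Pfin Y2.
rewrite covarianceE ?Lfun2_mul_Lfun1//.
by rewrite -(fineK (expectation_fin_num X1)) X0 mul0e sube0.
Qed.

End expectation_law.

Theorem lemma2 (R : realType) (d : measure_display) (T : measurableType d)
    (P : probability T R) (m : nat) (u : 'cV[R]_m)
    (epsilon : {RV P >-> 'cV[R]_m}) (Omega : 'M[R]_m)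
    (hm : (2 <= m)%N)
    (hu : euclidean_norm u = 1)
    (hmom : finite_second_moments P epsilon)
    (hmean : mean_vector P epsilon = 0)
    (hvar : covariance_mx P epsilon = Omega)
    (hH0 : H0 P u epsilon) :
  is_eigenvector Omega u.
Proof.
split.
  apply/eqP => u0; move: hu; rewrite /euclidean_norm u0.
  rewrite big1 ?sqrtr0; first by move=> /eqP; rewrite eq_sym oner_eq0.
  by move=> i _; rewrite mxE expr0n.
pose X i w : R := epsilon w i ord0.
pose Z w : R := (u^T *m epsilon w) ord0 ord0.
have ZE : Z = \sum_i (u i ord0 \o* X i).
  apply/funext => w; rewrite /Z mxE fct_sumE.
  by apply: eq_bigr => i _; rewrite mxE mulrC.
have X2 i : X i \in Lfun P 2%:E by exact: hmom.
have uX2 i : u i ord0 \o* X i \in Lfun P 2%:E.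
  by apply: Lfun_scale; rewrite ?ler1n.
have Z2 : Z \in Lfun P 2%:E.
  have p1 : (1 <= 2%:E :> \bar R)%E by rewrite lee_fin ler1n.
  rewrite ZE; elim/big_ind : _ => //.
    by have [] := Lfun_addr_closed P p1.
  by have [] := Lfun_addr_closed P p1.
have EX i : fine ('E_P[X i])%E = 0.
  by have /matrixP/(_ i ord0) := hmean; rewrite !mxE.
(* Bilinearity: since [Z] is the sum of the [u k ord0 * X k], the right side expands into the sum
   over [k] of the covariances of [X i] and [X k] weighted by [u k ord0]. *)
have OmegaE i : (Omega *m u) i ord0 = fine ('E_P[X i \* Z])%E.
  have XZ1 k : X i \* (u k ord0 \o* X k) \in Lfun P 1 by exact: Lfun2_mul_Lfun1.
  (* The sum runs over a list of functions, the form in which [expectation_sum] applies. *)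
  have -> : X i \* Z = \sum_(Y <- [seq X i \* (u k ord0 \o* X k) | k : 'I_m]) Y.
    rewrite big_image /= ZE; apply/funext => w.
    by rewrite /= !fct_sumE mulr_sumr.
  rewrite expectation_sum; last by move=> Y /mapP[k _ ->].
  rewrite big_image /= -sum_fine => [|k _]; last exact: expectation_fin_num.
  rewrite mxE; apply: eq_bigr => k _; rewrite -hvar mxE covariance_centered//; last exact: EX.
  rewrite (_ : X i \* (_ \o* _) = u k ord0 \o* (X i \* X k)); last first.
    by apply/funext => w /=; rewrite mulrA.
  have XX1 : X i \* X k \in Lfun P 1 by exact: Lfun2_mul_Lfun1.
  by rewrite expectationZl// fineM ?expectation_fin_num// mulrC.
have ZZ1 : Z \* Z \in Lfun P 1 by exact: Lfun2_mul_Lfun1.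
(* The eigenvalue is the variance of the centered variable [Z]. *)
exists (fine ('E_P[Z \* Z])%E); apply/colP => i; rewrite OmegaE !mxE.
have XZ1 : X i \* Z \in Lfun P 1 by exact: Lfun2_mul_Lfun1.
have cZZ1 : (2 * u i ord0) \o* (Z \* Z) \in Lfun P 1 by apply: Lfun_scale.
(* Test function for comparing the two laws: [f \o epsilon] is [X i \* Z] by conversion. *)
pose f (x : 'cV[R]_m) := x i ord0 * (u^T *m x) ord0 ord0.
have mf : measurable_fun setT f.
  apply: measurable_funM; first exact: measurable_coord_mx.
  apply: (measurableT_comp (measurable_coord_mx _ _)); exact: measurable_mulmx.
have fR : f \o (fun w => refl_mx u *m epsilon w) =
    ((2 * u i ord0) \o* (Z \* Z)) \- (X i \* Z).
  apply/funext => w /=; rewrite /f mulmxA mulmx_refl_mx_euclidean//.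
  rewrite -/(Z w) /refl_mx mulmxBl mul1mx -scalemxAl -mulmxA.
  (* Read as a scalar matrix, this 1 by 1 product turns [u *m (u^T *m epsilon w)] into a multiple of
     [u]. *)
  rewrite (_ : u^T *m epsilon w = (Z w)%:M); last first.
    by apply/matrixP => a b; rewrite !ord1 [RHS]mxE.
  by rewrite mul_mx_scalar !mxE /X; ring.
have fRm : f \o (fun w => refl_mx u *m epsilon w) \in Lfun P 1.
  by rewrite fR; exact: rpredB.
have mR : measurable_fun setT (fun w => refl_mx u *m epsilon w).
  by apply: (measurableT_comp (measurable_mulmx _)); exact: measurable_funPT.
have meps := @measurable_funPT _ _ _ _ epsilon.
have := same_law_expectation meps mR mf hH0 XZ1 fRm.
rewrite fR expectationB// expectationZl//.
(* All expectations here are finite, so the equality passes to the reals, where moving the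
   [X i \* Z] term across and cancelling 2 concludes. *)
move=> /(congr1 fine).
rewrite fineB ?fineM ?fin_numM ?expectation_fin_num//= => h.
have {}h : 2 * fine ('E_P[X i \* Z])%E = 2 * (u i ord0 * fine ('E_P[Z \* Z])%E).
  by rewrite mulrA -[RHS](subrK (fine ('E_P[X i \* Z])%E)) -h mulr2n mulrDl mul1r.
by rewrite mulrC; apply: (mulfI _ h); rewrite pnatr_eq0.
Qed.
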